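(* Let $(\widetilde{X},\tau,A)$ be a soft e-locally compact space such that for all $(O_1,A),(O_2,A)\in\tau$ we have $(O_1,A)\,\widetilde{\cap}\,(O_2,A)\in S(\widetilde{X})$. Then $(\widetilde{X},\tau,A)$ is a soft e-Baire space.
   Context: Let $X$ be a universe set and $A$ a nonempty set of parameters. A soft set over $X$ is a pair $(F,A)$ with $F:A\to\mathcal{P}(X)$. Write $(F,A)\,\widetilde{\subseteq}\,(G,A)$ if $F(\alpha)\subseteq G(\alpha)$ for all $\alpha\in A$; two soft sets are equal if each is a soft subset of the other. The soft union $\widetilde{\cup}$, soft intersection $\widetilde{\cap}$ and relative complement $(F,A)^C$ are taken pointwise: $\alpha\mapsto F(\alpha)\cup G(\alpha)$, $\alpha\mapsto F(\alpha)\cap G(\alpha)$, $\alpha\mapsto X\setminus F(\alpha)$. For $Y\subseteq X$, $(\widetilde{Y},A)$ is the soft set with constant value $Y$; $(\widetilde{\Phi},A)$ is the null soft set (constant value $\emptyset$). $S(\widetilde{X})$ is the collection consisting of $(\widetilde{\Phi},A)$ and all soft sets $(F,A)$ over $X$ with $F(\alpha)\neq\emptyset$ for all $\alpha\in A$. A soft element of $(\widetilde{X},A)$ is a function $\widetilde{x}:A\to X$; $\widetilde{x}\,\widetilde{\in}\,(F,A)$ means $\widetilde{x}(\alpha)\in F(\alpha)$ for all $\alpha\in A$. $SE(F,A)$ is the set of soft elements belonging to $(F,A)$. For a collection $\mathcal{B}$ of soft elements, $SS(\mathcal{B})$ is the soft set $\alpha\mapsto\{\widetilde{x}(\alpha):\widetilde{x}\in\mathcal{B}\}$.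 Elementary union, intersection and complement: $\Cup_i(F_i,A)=SS(\bigcup_i SE(F_i,A))$, $\Cap_i(F_i,A)=SS(\bigcap_i SE(F_i,A))$, $(F,A)^{\mathbb{C}}=SS(\{\widetilde{x}:\widetilde{x}\,\widetilde{\in}\,(F,A)^C\})$. A soft e-topology on $(\widetilde{X},A)$ is a collection $\tau\subseteq S(\widetilde{X})$ containing $(\widetilde{\Phi},A)$ and $(\widetilde{X},A)$, closed under arbitrary elementary unions and under elementary intersection of two members. Then $(\widetilde{X},\tau,A)$ is a soft e-topological space; members of $\tau$ are the soft e-open sets. $(F,A)\in S(\widetilde{X})$ is soft e-closed if $(F,A)^C\in S(\widetilde{X})$ and $(F,A)^{\mathbb{C}}\in\tau$. The space is soft e-Hausdorff if for any soft elements $\widetilde{x},\widetilde{y}$ with $\widetilde{x}(\alpha)\neq\widetilde{y}(\alpha)$ for all $\alpha\in A$ there exist $(F,A),(G,A)\in\tau$ with $\widetilde{x}\,\widetilde{\in}\,(F,A)$, $\widetilde{y}\,\widetilde{\in}\,(G,A)$ and $(F,A)\,\widetilde{\cap}\,(G,A)=(\widetilde{\Phi},A)$. A family $\{(O_i,A)\}_{i\in I}$ of soft e-open sets is a soft e-open cover of $(F,A)\in S(\widetilde{X})$ if $(F,A)\,\widetilde{\subseteq}\,\Cup_{i\in I}(O_i,A)$. In a soft e-Hausdorff space, a soft set $(F,A)\in S(\widetilde{X})$ with $(F,A)^C\in S(\widetilde{X})$ is a soft e-compact set if every soft e-open cover of $(F,A)$ has a finite subfamily that is still a soft e-open cover of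 $(F,A)$. A soft set $(N,A)\in S(\widetilde{X})$, $(N,A)\neq(\widetilde{\Phi},A)$, is a soft neighborhood of a soft element $\widetilde{x}$ if there is $(G,A)\in\tau$ with $\widetilde{x}\,\widetilde{\in}\,(G,A)\,\widetilde{\subseteq}\,(N,A)$. A soft e-compact neighborhood is a soft neighborhood that is a soft e-compact set. A soft e-Hausdorff space is soft e-locally compact if for every soft element $\widetilde{x}$ of $(\widetilde{X},A)$ and every soft neighborhood $(N,A)$ of $\widetilde{x}$ there is a soft e-compact neighborhood $(K,A)$ of $\widetilde{x}$ with $(K,A)\,\widetilde{\subseteq}\,(N,A)$. The soft interior of $(F,A)\in S(\widetilde{X})$ is $SS(\{\widetilde{x}\,\widetilde{\in}\,(F,A):\ \widetilde{x}\,\widetilde{\in}\,(G,A)\,\widetilde{\subseteq}\,(F,A)\text{ for some }(G,A)\in\tau\})$. A soft e-Hausdorff space is a soft e-Baire space if for every countable family $\{(F_i,A)\}_{i=1}^{\infty}$ of soft e-closed sets, each having soft interior $(\widetilde{\Phi},A)$, the soft interior of $\Cup_{i=1}^{\infty}(F_i,A)$ is $(\widetilde{\Phi},A)$. *)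

(* Defs.v *)
From mathcomp Require Import all_boot all_classical.
Set Implicit Arguments.
Unset Strict Implicit.
Unset Printing Implicit Defensive.
Local Open Scope classical_set_scope.

(* By functional and propositional extensionality, Leibniz equality of soft sets
   coincides with mutual soft inclusion. *)
Definition soft_set (X A : Type) : Type := A -> set X.

Definition soft_element (X A : Type) : Type := A -> X.

Definition soft_subset (X A : Type) (F G : soft_set X A) : Prop :=
  forall a, F a `<=` G a.

Definition soft_inter (X A : Type) (F G : soft_set X A) : soft_set X A :=
  fun a => F a `&` G a.

Definition soft_compl (X A : Type) (F : soft_set X A) : soft_set X A :=
  fun a => ~` F a.

Definition soft_const (X A : Type) (Y : set X) : soft_set X A := fun _ => Y.

Definition soft_null (X A : Type) : soft_set X A := soft_const set0.
Arguments soft_null : clear implicits.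

Definition soft_full (X A : Type) : soft_set X A := soft_const setT.
Arguments soft_full : clear implicits.

(* The collection S(X~): no mixture of empty and nonempty values is allowed. *)
Definition soft_S (X A : Type) : set (soft_set X A) :=
  [set F | F = soft_null X A \/ forall a, F a !=set0].

Definition SE (X A : Type) (F : soft_set X A) : set (soft_element X A) :=
  [set x | forall a, F a (x a)].

Definition SS (X A : Type) (B : set (soft_element X A)) : soft_set X A :=
  fun a => [set x a | x in B].

Definition elem_union (X A I : Type) (D : set I) (F : I -> soft_set X A) :
    soft_set X A :=
  SS (\bigcup_(i in D) SE (F i)).

Definition elem_inter (X A : Type) (F G : soft_set X A) : soft_set X A :=
  SS (SE F `&` SE G).

Definition elem_compl (X A : Type) (F : soft_set X A) : soft_set X A :=
  SS (SE (soft_compl F)).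

Record soft_e_topology (X A : Type) : Type := SoftETopology {
  soft_e_open :> soft_set X A -> Prop;
  soft_e_open_S : forall F : soft_set X A, soft_e_open F -> soft_S F;
  soft_e_open_null : soft_e_open (soft_null X A);
  soft_e_open_full : soft_e_open (soft_full X A);
  soft_e_open_union : forall (I : Type) (F : I -> soft_set X A),
    (forall i, soft_e_open (F i)) -> soft_e_open (elem_union setT F);
  soft_e_open_inter : forall F G : soft_set X A,
    soft_e_open F -> soft_e_open G -> soft_e_open (elem_inter F G)
}.

Definition soft_e_closed (X A : Type) (tau : soft_e_topology X A)
    (F : soft_set X A) : Prop :=
  [/\ soft_S F, soft_S (soft_compl F) & tau (elem_compl F)].

Definition soft_e_hausdorff (X A : Type) (tau : soft_e_topology X A) : Prop :=
  forall x y : soft_element X A, (forall a, x a <> y a) ->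
    exists F G : soft_set X A,
      [/\ tau F, tau G, SE F x, SE G y & soft_inter F G = soft_null X A].

(* The subfamily of O indexed by D is a soft e-open cover of F. *)
Definition soft_e_open_cover (X A : Type) (tau : soft_e_topology X A)
    (I : Type) (D : set I) (O : I -> soft_set X A) (F : soft_set X A) : Prop :=
  (forall i, D i -> tau (O i)) /\ soft_subset F (elem_union D O).

(* Only meaningful in a soft e-Hausdorff space; the spaces below that use it
   carry the Hausdorff condition themselves. *)
Definition soft_e_compact (X A : Type) (tau : soft_e_topology X A)
    (F : soft_set X A) : Prop :=
  [/\ soft_S F, soft_S (soft_compl F) &
    forall (I : Type) (O : I -> soft_set X A),
      soft_e_open_cover tau setT O F ->
      exists2 J : set I, finite_set J & soft_e_open_cover tau J O F].

Definition soft_nbhd (X A : Type) (tau : soft_e_topology X A)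
    (x : soft_element X A) (N : soft_set X A) : Prop :=
  [/\ soft_S N, N <> soft_null X A &
    exists G : soft_set X A, [/\ tau G, SE G x & soft_subset G N]].

Definition soft_e_locally_compact (X A : Type) (tau : soft_e_topology X A) :
    Prop :=
  soft_e_hausdorff tau /\
  forall (x : soft_element X A) (N : soft_set X A), soft_nbhd tau x N ->
    exists K : soft_set X A,
      [/\ soft_nbhd tau x K, soft_e_compact tau K & soft_subset K N].

Definition soft_interior (X A : Type) (tau : soft_e_topology X A)
    (F : soft_set X A) : soft_set X A :=
  SS [set x | SE F x /\
    exists G : soft_set X A, [/\ tau G, SE G x & soft_subset G F]].

Definition soft_e_baire (X A : Type) (tau : soft_e_topology X A) : Prop :=
  soft_e_hausdorff tau /\
  forall F : nat -> soft_set X A,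
    (forall i, soft_e_closed tau (F i)) ->
    (forall i, soft_interior tau (F i) = soft_null X A) ->
    soft_interior tau (elem_union setT F) = soft_null X A.

(* Main.v *)
Require Import Defs.
From mathcomp Require Import all_boot all_classical.

(** On members of S(X~) the elementary operations are the pointwise ones, and
    the hypothesis on intersections makes tau stable under pointwise
    intersection.  Hence the classical proof applies: soft e-compact sets have
    open complements, and inside an open set contained in the union of the
    [F i] one builds a decreasing sequence of nonnull compact sets, the i-th
    one avoiding [F i].  Compactness gives a parameter at which all of them
    share a point, and that single parameter suffices for a contradiction. *)

Set Implicit Arguments.
Unset Strict Implicit.
Unset Printing Implicit Defensive.
Local Open Scope classical_set_scope.

Lemma SE_null (X A : Type) (hA : inhabited A) (x : soft_element X A) :
  ~ SE (soft_null X A) x.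
Proof. by case: hA => a /(_ a). Qed.

(** When no value of [F] is empty, choice gives some soft element of [F], and its value at [a] may
    be overwritten by [z]. If [F] is null, [F a z] is absurd. *)
Lemma SE_through (X A : Type) (F : soft_set X A) (a : A) (z : X) :
  soft_S F -> F a z -> exists2 x, SE F x & x a = z.
Proof.
move=> [-> []|Fne Faz].
have [x xF] := choice Fne.
exists (fun b => if pselect (b = a) then z else x b) => [b|] /=.
  by case: pselect => [ba|_] /=; [rewrite ba|apply: xF].
by case: pselect.
Qed.

Lemma SS_SE (X A : Type) (F : soft_set X A) : soft_S F -> SS (SE F) = F.
Proof.
move=> SF; apply/funext => a; apply/seteqP; split=> [_ [x xF <-]|z Fz].
  exact: xF.
by have [x xF <-] := SE_through SF Fz; exists x.
Qed.

Lemma elem_unionP (X A I : Type) (D : set I) (F : I -> soft_set X A) a z :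
  (forall i, soft_S (F i)) ->
  elem_union D F a z <-> exists2 i, D i & F i a z.
Proof.
move=> SF; split=> [[x [i Di xF] <-]|[i Di Fz]]; first by exists i.
by have [x xF <-] := SE_through (SF i) Fz; exists x => //; exists i.
Qed.

Lemma open_soft_inter (X A : Type) (tau : soft_e_topology X A)
    (F G : soft_set X A) :
  soft_S (soft_inter F G) -> tau F -> tau G -> tau (soft_inter F G).
Proof.
move=> SFG oF oG; rewrite -(SS_SE SFG).
suff -> : SE (soft_inter F G) = SE F `&` SE G by apply: soft_e_open_inter.
apply/seteqP; split=> x; first by move=> xFG; split=> a; have [] := xFG a.
by move=> [xF xG] a; split; [apply: xF|apply: xG].
Qed.

Lemma open_of_nbhds (X A : Type) (tau : soft_e_topology X A)
    (G : soft_set X A) :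
  soft_S G ->
  (forall x, SE G x -> exists V, [/\ tau V, SE V x & soft_subset V G]) ->
  tau G.
Proof.
move=> SG nbG.
have /choice[V VP] x : exists V,
    [/\ tau V, SE G x -> SE V x & soft_subset V G].
  have [/nbG[V [oV xV VG]]|nGx] := pselect (SE G x); first by exists V.
  (* Soft elements outside [G] receive the null soft set, which adds nothing to the union. *)
  by exists (soft_null X A); split=> // [|a z []]; apply: soft_e_open_null.
have SV x : soft_S (V x) by have [/soft_e_open_S] := VP x.
suff -> : G = elem_union setT V by apply: soft_e_open_union => x; case: (VP x).
apply/funext => a; apply/seteqP; split=> z.
  move=> Gz; have [x xG <-] := SE_through SG Gz.
  by apply/elem_unionP => //; exists x => //; have [_ /(_ xG)] := VP x.
by move=> /(elem_unionP _ _ _ SV)[x _]; have [_ _] := VP x; apply.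
Qed.

Lemma open_finite_inter (X A I : Type) (tau : soft_e_topology X A)
    (P : I -> soft_set X A) (J : set I) (y : soft_element X A) :
  (forall F G, tau F -> tau G -> tau (soft_inter F G)) ->
  finite_set J -> (forall i, tau (P i)) -> (forall i, SE (P i) y) ->
  exists V, [/\ tau V, SE V y & forall i, J i -> soft_subset V (P i)].
Proof.
(* [I] gets a decidable equality, so that the finite set [J] can be listed as a sequence. *)
elim/Pchoice: I => I in P J *.
move=> openI /finite_seqP[s ->] oP yP; elim: s => [|i s [V [oV yV VP]]].
  by exists (soft_full X A); split=> //; apply: soft_e_open_full.
exists (soft_inter (P i) V); split; first exact: openI.
  by move=> a; split; [apply: yP|apply: yV].
move=> j /=; rewrite inE => /orP[/eqP -> a z []//|js a z [_]].
exact: (VP j js).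
Qed.

Lemma compact_compl_open (X A : Type) (tau : soft_e_topology X A)
    (K : soft_set X A) :
  (forall F G, tau F -> tau G -> tau (soft_inter F G)) ->
  soft_e_hausdorff tau -> soft_e_compact tau K -> tau (soft_compl K).
Proof.
move=> openI haus [SK SKc compK]; apply: open_of_nbhds => // y yKc.
have /choice[O OP] x : exists O : soft_set X A * soft_set X A,
    [/\ tau O.1, tau O.2, SE K x -> SE O.1 x, SE O.2 y &
        forall a z, O.1 a z -> O.2 a z -> False].
  have [xK|nKx] := pselect (SE K x); last first.
    (* Harmless default off [K]: the pair is disjoint and its second component contains [y]. *)
    exists (soft_null X A, soft_full X A); split=> //.
      exact: soft_e_open_null.
    exact: soft_e_open_full.
  (* The Hausdorff condition needs [x] and [y] to differ at every parameter; they do, as [x a] lies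
     in [K a] and [y a] never does. *)
  have /haus[F [G [oF oG xF yG FG0]]] a : x a <> y a.
    by move=> xya; apply: (yKc a); rewrite -xya; apply: xK.
  exists (F, G); split=> // a z Fz Gz.
  by have : soft_inter F G a z by []; rewrite FG0.
have SO x : soft_S (O x).1 by have [/soft_e_open_S] := OP x.
have [|J finJ [_ KJ]] := compK _ (fun x => (O x).1).
  split=> [x _|a z Kz]; first by case: (OP x).
  have [x xK <-] := SE_through SK Kz.
  by apply/elem_unionP => //; exists x => //; have [_ _ /(_ xK)] := OP x.
have [||V [oV yV VO]] :=
  @open_finite_inter _ _ _ tau (fun x => (O x).2) J y openI finJ.
- by move=> x; case: (OP x).
- by move=> x; case: (OP x).
exists V; split=> // a z Vz /KJ /(elem_unionP _ _ _ SO)[x Jx Oz].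
have [_ _ _ _ disj] := OP x.
exact: (disj a z Oz (VO x Jx a z Vz)).
Qed.

(** Without a common point the complements would cover [K 0]. A finite subcover is refuted at any
    one parameter by a soft element of the [K n] of largest index involved. *)
Lemma compact_nested_inter (X A : Type) (hA : inhabited A)
    (tau : soft_e_topology X A) (K : nat -> soft_set X A) :
  (forall n, soft_e_compact tau (K n)) -> (forall n, tau (soft_compl (K n))) ->
  (forall n, SE (K n) !=set0) -> (forall n, soft_subset (K n.+1) (K n)) ->
  exists a z, forall n, K n a z.
Proof.
move=> compK oKc Kne Kdec.
have Kle m n : m <= n -> soft_subset (K n) (K m).
  elim: n => [|n IHn]; first by rewrite leqn0 => /eqP -> a.
  by rewrite leq_eqVlt => /orP[/eqP -> a //|/IHn KK a z /Kdec/KK].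
have SKc n : soft_S (soft_compl (K n)) by apply: soft_e_open_S (oKc n).
apply: contrapT => noz.
have [_ _ /(_ _ (fun n => soft_compl (K n)))[]] := compK 0.
  split=> // a z _; apply/elem_unionP => //.
  apply: contrapT => nz; apply: noz; exists a, z => n.
  by apply: contrapT => nKz; apply: nz; exists n.
move=> J /finite_seqP[s ->] [_ cov]; case: hA => a.
have [x xK] := Kne (\max_(i <- s) i).
have /(Kle 0 _ (leq0n _))/cov := xK a.
move=> /(elem_unionP _ _ _ SKc)[n /= ns]; apply.
exact: Kle (leq_bigmax_seq n ns isT) a _ (xK a).
Qed.

Lemma compact_step (X A : Type) (hA : inhabited A)
    (tau : soft_e_topology X A) (F U : soft_set X A) :
  (forall F G, tau F -> tau G -> tau (soft_inter F G)) ->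
  soft_e_locally_compact tau -> soft_e_closed tau F ->
  soft_interior tau F = soft_null X A ->
  tau U -> SE U !=set0 ->
  exists K V, [/\ soft_e_compact tau K, soft_subset K (soft_inter U (soft_compl F)),
    tau V, SE V !=set0 & soft_subset V K].
Proof.
move=> openI [_ lc] [SF SFc oFc] F0 oU [x xU].
rewrite /elem_compl SS_SE // in oFc.
have oW := openI _ _ oU oFc; set W := soft_inter _ _ in oW *.
have SW : soft_S W by apply: soft_e_open_S oW.
(* Otherwise [U] would lie inside [F], putting [x] in the null interior. One nonempty value is
   enough: [W] is in S(X~), so a soft element passes through it. *)
have [a [z Wz]] : exists a z, W a z.
  apply: contrapT => nW; apply: (SE_null hA (x := x)); rewrite -F0 => a.
  have UF : soft_subset U F.
    by move=> b z Uz; apply: contrapT => nFz; apply: nW; exists b, z.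
  exists x => //; split; last by exists U.
  by move=> b; apply: UF; apply: xU.
have [y yW _] := SE_through SW Wz.
have /lc[K [[_ _ [V [oV yV VK]]] compK KW]] : soft_nbhd tau y W.
  split=> //; last by exists W; split=> // b.
  by move=> W0; apply: (SE_null hA (x := y)); rewrite -W0.
by exists K, V; split=> //; exists y.
Qed.

Theorem theorem5p1 (X A : Type) (hA : inhabited A)
    (tau : soft_e_topology X A) :
  soft_e_locally_compact tau ->
  (forall O1 O2 : soft_set X A, tau O1 -> tau O2 ->
    soft_S (soft_inter O1 O2)) ->
  soft_e_baire tau.
Proof.
move=> lc SI.
have openI F G : tau F -> tau G -> tau (soft_inter F G).
  by move=> oF oG; apply: open_soft_inter => //; apply: SI.
split=> [|F clF F0]; first by case: lc.
apply/funext => b; apply/seteqP; split=> // _ [x [_ [G [oG xG GF]]] <-].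
(* [f] maps a stage [(n, U)] to a compact set and an open set inside it. It is total, with a junk
   value when [U] is not a nonnull open set, so the recursion below carries no proofs. *)
have /choice[f fP] (p : nat * soft_set X A) : exists q : soft_set X A * soft_set X A,
    tau p.2 -> SE p.2 !=set0 ->
    [/\ soft_e_compact tau q.1,
        soft_subset q.1 (soft_inter p.2 (soft_compl (F p.1))),
        tau q.2, SE q.2 !=set0 & soft_subset q.2 q.1].
  have [[oU Une]|nU] := pselect (tau p.2 /\ SE p.2 !=set0); last first.
    by exists (p.2, p.2) => oU Une; case: nU.
  have [K [V KV]] := compact_step hA openI lc (clF p.1) (F0 p.1) oU Une.
  by exists (K, V).
pose U := fix U n := if n is m.+1 then (f (m, U m)).2 else G.
pose K n := (f (n, U n)).1.
have UP n : tau (U n) /\ SE (U n) !=set0.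
  elim: n => [|n [oU Une]]; first by split=> //; exists x.
  by have [_ _ oV Vne _] := fP (n, U n) oU Une.
have KP n : [/\ soft_e_compact tau (K n),
    soft_subset (K n) (soft_inter (U n) (soft_compl (F n))),
    SE (U n.+1) !=set0 & soft_subset (U n.+1) (K n)].
  by have [oU Une] := UP n; have [] := fP (n, U n) oU Une.
have [||||a [z Kz]] := @compact_nested_inter _ _ hA tau K.
- by move=> n; case: (KP n).
- by move=> n; apply: compact_compl_open => //; case: (KP n) => //; case: lc.
- by move=> n; have [_ _ [y yU] UK] := KP n; exists y => c; apply: UK.
- move=> n c w; have [_ KU _ _] := KP n.+1; have [_ _ _ UK] := KP n.
  by move=> /KU[/UK].
(* Since [U 0] is [G], the point [z] lies in some [F i a], yet [K i] avoids [F i]. *)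
have [_ /(_ a z (Kz 0))[/GF]] := KP 0.
move=> [y [i _ yF] yz] _ _ _.
by have [_ /(_ a z (Kz i))[_ nFz] _ _] := KP i;
   apply: nFz; rewrite -yz; apply: yF.
Qed.
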